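(* Let $\mathcal M$ be a loop-free matroid on $\{1,\dots,m\}$. The tautological tropical toric vector bundle $\mathfrak E_{\mathcal M}$ on the permutahedral variety $X_m$ is globally generated and nef.
   Context: Bergman fan and apartments. For a loop-free matroid $\mathcal M$ of rank $r$, $\operatorname{Berg}(\mathcal M)\subset\mathbb R^{\mathcal M}$ is the set of $w$ such that for every circuit $C$ the minimum $\min_{i\in C}w_i$ is attained at least twice (equivalently, all sets $\{i:w_i\ge t\}$ are flats). For a basis $B$, the apartment $A_B$ is the set of $w\in\operatorname{Berg}(\mathcal M)$ for which $\sum_{b\in B}w_b$ is maximal among all bases; projection to the $B$-coordinates identifies $A_B$ with $\mathbb R^B$. Tautological bundle. $\Sigma_m$ is the complete fan in $\mathbb R^m$ (with lineality space $\mathbb R(1,\dots,1)$) whose maximal cones are $\{w:w_{\pi(1)}\ge\dots\ge w_{\pi(m)}\}$, $\pi\in S_m$. $X_m$ is the toric variety of its image in $\mathbb R^m/\mathbb R(1,\dots,1)$, with the torus $T=\mathbb G_m^m$ (character lattice $\mathbb Z^m$) acting through its quotient by the diagonal. $\mathfrak E_{\mathcal M}$ is given by the map $\Phi=\Phi_{\mathcal M}:\mathbb R^m\to\operatorname{Berg}(\mathcal M)$, $\Phi(w)_e=\sup\{k: e\in\operatorname{span}\{j:w_j\ge k\}\}$ (span = matroid closure). Write $\mathfrak v(e)(x)=\Phi(x)_e$. Each $\mathfrak v(e)$ is linear on every cone of $\Sigma_m$. Globally generated. For $u\in\mathbb Z^m$ put $H^0(X_m,\mathfrak E_{\mathcal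 M})_u=\{e\in\mathcal M:\langle u,x\rangle\le\mathfrak v(e)(x)\ \forall x\in\mathbb R^m\}$. For a maximal cone $\sigma$ and $u\in\mathbb Z^m$ let $F_{\sigma,u}=\{e:\mathfrak v(e)(x)\ge\langle u,x\rangle\ \forall x\in\sigma\}$, a flat, and let $F_{\sigma,>u}$ be the span of the union of all $F_{\sigma,u'}$ with $u'\ne u$ and $u'\ge u$ on $\sigma$. The matroid fiber at $\sigma$ is the direct sum of the quotient (contraction) matroids $\mathfrak E_\sigma=\bigoplus_u F_{\sigma,u}/F_{\sigma,>u}$. The bundle is globally generated if for each maximal $\sigma$ the elements of $\mathfrak E_\sigma$ given by the pairs $(e,u)$ with $e\in H^0(X_m,\mathfrak E_{\mathcal M})_u$ and $e\notin F_{\sigma,>u}$ (placed in the summand indexed by $u$) contain a basis of $\mathfrak E_\sigma$. Bundles on toric curves. Let $\tau$ be a codimension-one cone of $\Sigma_m$, $\sigma,\sigma'$ the two maximal cones containing it, $C_\tau\cong\mathbb P^1$ the corresponding toric curve, and $\eta_\tau\in\mathbb Z^m$ the primitive generator of $\tau^\perp$ that is nonnegative on $\sigma$. A $T$-equivariant tropical bundle on $C_\tau$ is a pair $(\mathcal N,\Psi)$ with $\mathcal N$ a loop-free matroid and $\Psi:\mathbb R^m\to\operatorname{Berg}(\mathcal N)$, sending integral points to integral points, such that each half-space $\{\eta_\tau\ge0\}$, $\{\eta_\tau\le0\}$ is mapped into a single apartment, linearly in its coordinates. The line bundle $\mathcal O(a)$ is given by a one-element matroid of rank one and a function $\Psi$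 equal to integral linear forms $u_+$ on $\{\eta_\tau\ge0\}$ and $u_-$ on $\{\eta_\tau\le0\}$ with $u_+-u_-=a\eta_\tau$; a direct sum of such is given by the free matroid $U_{r,r}$ with the corresponding coordinate functions. A matroid extension $\phi:\mathcal N_1\to\mathcal N_2$ is an injection of ground sets of matroids of equal rank such that the matroid induced by $\mathcal N_2$ on $\phi(\mathcal N_1)$ is $\mathcal N_1$; it induces $\phi_*:\operatorname{Berg}(\mathcal N_1)\to\operatorname{Berg}(\mathcal N_2)$, $(\phi_*w)_e=\sup\{t:e\in\operatorname{span}\phi(\{i:w_i\ge t\})\}$. Equivalence of bundles is the equivalence relation generated by $(\mathcal N_1,\Psi)\sim(\mathcal N_2,\phi_*\circ\Psi)$. Restriction to $C_\tau$. Fix $x$ in the relative interior of $\tau$. $\mathfrak E_{\mathcal M}|_{C_\tau}$ is the pair $(\mathcal M_x,\Psi_\tau)$, where $\mathcal M_x$ is the matroid whose bases are the bases $B$ of $\mathcal M$ maximizing $\sum_{b\in B}\Phi(x)_b$, and $\Psi_\tau(y)=\lim_{\varepsilon\to0^+}(\Phi(x+\varepsilon y)-\Phi(x))/\varepsilon$. This is independent of $x$. Nef. $\mathfrak E_{\mathcal M}$ is nef if for every $\tau$ the restriction $\mathfrak E_{\mathcal M}|_{C_\tau}$ is equivalent to a direct sum of line bundles $\mathcal O(a_j)$ with all $a_j\ge0$. *)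

(* Defs.v *)
From HB Require Import structures.
From mathcomp Require Import all_boot all_order all_algebra all_fingroup.

Set Implicit Arguments.
Unset Strict Implicit.
Unset Printing Implicit Defensive.

Import Order.TTheory GRing.Theory Num.Theory.

Local Open Scope ring_scope.

Definition base_exchange (E : finType) (bs : {set {set E}}) :=
  forall B1 B2 : {set E}, B1 \in bs -> B2 \in bs ->
  forall e, e \in B1 :\: B2 ->
  exists2 f, f \in B2 :\: B1 & f |: (B1 :\ e) \in bs.

Record matroid (E : finType) := Matroid {
  bases : {set {set E}};
  bases_n0 : bases != set0;
  bases_exchange : base_exchange bases
}.

Section Matroid.
Variable E : finType.
Implicit Types (M : matroid E) (A B F G I C : {set E}) (e : E).

Definition indep M I := [exists B in bases M, I \subset B].

Definition loopfree M := forall e, indep M [set e].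

Definition circuit M C := minset (fun A => ~~ indep M A) C.

Definition rk M A := (\max_(B in bases M) #|B :&: A|)%N.

Definition span M A : {set E} := [set e | rk M (e |: A) == rk M A]%SET.

(* B is a basis of the restriction M|F *)
Definition restr_basis M F B :=
  maxset (fun I => indep M I && (I \subset F)) B.

(* B is a basis of the minor F/G = (M|F)/G, for G contained in F *)
Definition minor_basis M F G B :=
  (B \subset F :\: G) &&
  [exists I, restr_basis M G I && restr_basis M F (I :|: B)].

End Matroid.

Section InitialMatroid.
Variables (E : finType) (M : matroid E).
Implicit Types (A B D I : {set E}).

Lemma bases_card_le B1 B2 :
  B1 \in bases M -> B2 \in bases M -> (#|B2| <= #|B1|)%N.
Proof.
have [n] := ubnP #|B1 :\: B2|; elim: n B1 => // n IHn B1 ltn hB1 hB2.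
have [sub|/subsetPn[e eB1 eNB2]] := boolP (B1 \subset B2).
  have [->//|/eqP nB] := eqVneq B1 B2.
  have /subsetPn[e eB2 eNB1] : ~~ (B2 \subset B1).
    by apply/negP => sub'; apply: nB; apply/eqP; rewrite eqEsubset sub.
  have eD : e \in B2 :\: B1 by rewrite inE eNB1.
  have [f] := bases_exchange hB2 hB1 eD.
  by rewrite inE => /andP[/negP fN /(subsetP sub)].
have eD : e \in B1 :\: B2 by rewrite inE eNB2.
have [f] := bases_exchange hB1 hB2 eD.
rewrite inE => /andP[fNB1 fB2] hB.
have -> : #|B1| = #|f |: (B1 :\ e)|.
  by rewrite cardsU1 !inE (negPf fNB1) andbF (cardsD1 e B1) eB1.
apply: IHn hB hB2; rewrite ltnS in ltn; apply: leq_trans ltn.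
apply/proper_card/properP; split.
  apply/subsetP => x; rewrite !inE => /andP[xN /orP[/eqP xf|/andP[_ ->]]].
    by rewrite xf fB2 in xN.
  by rewrite xN.
exists e; first by rewrite inE eNB2.
by rewrite !inE eqxx orbF; case: eqVneq => [ef|]; [rewrite ef fB2 in eNB2|rewrite andbF].
Qed.

Lemma bases_card B1 B2 : B1 \in bases M -> B2 \in bases M -> #|B1| = #|B2|.
Proof. by move=> h1 h2; apply/eqP; rewrite eqn_leq !bases_card_le. Qed.

Lemma indep_extend I B : indep M I -> B \in bases M ->
  exists2 B', B' \in bases M & (I \subset B') && (B' \subset I :|: B).
Proof.
move=> /existsP[B0 /andP[hB0 IB0]] hB.
have [n] := ubnP #|B0 :\: (I :|: B)|; elim: n B0 hB0 IB0 => // n IHn B0 hB0 IB0 lt.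
have [sub|/subsetPn[x xB0 xN]] := boolP (B0 \subset I :|: B).
  by exists B0 => //; rewrite IB0.
move: (xN); rewrite inE negb_or => /andP[xNI xNB].
have xD : x \in B0 :\: B by rewrite inE xNB.
have [y] := bases_exchange hB0 hB xD.
rewrite inE => /andP[yNB0 yB] hB'; apply: IHn hB' _ _.
  apply/subsetP => z zI; rewrite !inE (subsetP IB0 _ zI) andbT.
  by apply/orP; right; apply: contraNneq xNI => <-.
rewrite ltnS in lt; apply: leq_trans lt; apply/proper_card/properP; split.
  apply/subsetP => z; rewrite !inE.
  by move=> /andP[zN /orP[/eqP zy|/andP[_ ->]]]; [rewrite zy yB orbT in zN|rewrite zN].
exists x; first by rewrite inE xN.
by rewrite !inE eqxx orbF; case: eqVneq => [xy|]; [rewrite xy yB in xNB|rewrite andbF].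
Qed.

Lemma symmetric_exchange B1 B2 : B1 \in bases M -> B2 \in bases M ->
  forall e, e \in B1 :\: B2 ->
  exists2 f, f \in B2 :\: B1 &
    (f |: (B1 :\ e) \in bases M) && (e |: (B2 :\ f) \in bases M).
Proof.
move=> hB1 hB2 e; rewrite inE => /andP[eNB2 eB1].
pose D := [set f in B2 | e |: (B2 :\ f) \in bases M]%SET.
pose K := [set f in B2 | f |: (B1 :\ e) \in bases M]%SET.
have [/pred0P nf|/pred0Pn[f]] := boolP [disjoint K & D]; last first.
  rewrite /= !inE => /andP[/andP[fB2 h1] /andP[_ h2]].
  exists f; last by rewrite h1.
  rewrite inE fB2 andbT; apply/negP => fB1.
  have fe : f != e by apply: contraNneq eNB2 => <-.
  have E1 : f |: (B1 :\ e) = B1 :\ e by apply/setUidPr; rewrite sub1set !inE fe.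
  have := bases_card hB1 h1; rewrite E1 (cardsD1 e B1) eB1.
  by move=> /eqP; rewrite -[X in _ == X]add0n eqn_add2r.
have DB2 : D \subset B2 by apply/subsetP => x; rewrite inE => /andP[].
exfalso.
have iD : indep M D by apply/existsP; exists B2; rewrite hB2.
have [B' hB' /andP[DB' B'D]] := indep_extend iD hB1.
have eB' : e \in B'.
  apply/negPn/negP => eNB'.
  have iB1e : indep M (B1 :\ e).
    by apply/existsP; exists B1; rewrite hB1 subD1set.
  have [B'' hB'' /andP[s1 s2]] := indep_extend iB1e hB'.
  have /subsetPn[f fB'' fN] : ~~ (B'' \subset B1 :\ e).
    apply/negP => /subset_leq_card; rewrite (bases_card hB'' hB1) (cardsD1 e B1) eB1.
    by rewrite ltnn.
  have fB' : f \in B' by move: (subsetP s2 _ fB''); rewrite inE (negPf fN).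
  have fe : f != e by apply: contraNneq eNB' => <-.
  have fD : f \in D.
    have := subsetP B'D _ fB'; rewrite inE => /orP[//|fB1].
    by rewrite !inE fe fB1 in fN.
  suff fK : f \in K by have := nf f; rewrite /= fK fD.
  rewrite inE (subsetP DB2 _ fD) /=.
  suff -> : f |: (B1 :\ e) = B'' by [].
  apply/eqP; rewrite eqEcard subUset sub1set fB'' s1 /=.
  by rewrite cardsU1 fN (bases_card hB'' hB1) (cardsD1 e B1) eB1.
have iJ : indep M (e |: D).
  by apply/existsP; exists B'; rewrite hB' subUset sub1set eB'.
have [B3 hB3 /andP[J3 B3J]] := indep_extend iJ hB2.
have B3e : B3 \subset e |: B2.
  apply: (subset_trans B3J); rewrite -setUA; apply: setUS.
  by rewrite subUset DB2 /=.
have eB3 : e \in B3 by apply: (subsetP J3); rewrite setU11.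
have /subsetPn[g gB2 gN] : ~~ (B2 \subset B3).
  apply/negP => sub; have : e |: B2 \subset B3 by rewrite subUset sub1set eB3.
  by move/subset_leq_card; rewrite cardsU1 eNB2 (bases_card hB3 hB2) ltnn.
have B3E : B3 = e |: (B2 :\ g).
  apply/eqP; rewrite eqEcard; apply/andP; split.
    apply/subsetP => x xB3; have := subsetP B3e _ xB3.
    rewrite !inE => /orP[->//|xB2]; rewrite xB2 andbT.
    by apply/orP; right; apply: contraNneq gN => <-.
  rewrite cardsU1 !inE (negPf eNB2) andbF /= (bases_card hB3 hB2).
  by rewrite (cardsD1 g B2) gB2.
have gD : g \in D by rewrite inE gB2 -B3E.
by case/negP: gN; apply: (subsetP J3); rewrite inE gD orbT.
Qed.

Variables (R : realDomainType) (w : {ffun E -> R}).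

Definition initial_bases : {set {set E}} :=
  [set B in bases M | [forall B' in bases M,
     \sum_(b in B') w b <= \sum_(b in B) w b]]%SET.

Lemma initial_n0 : initial_bases != set0.
Proof.
have [B0 hB0] := set0Pn _ (bases_n0 M).
case: (@Order.TotalTheory.arg_maxP _ _ _ B0 (mem (bases M))
  (fun B => \sum_(b in B) w b) hB0) => B hB maxB.
apply/set0Pn; exists B; rewrite inE; apply/andP; split=> //.
by apply/forall_inP => B' hB'; apply: maxB.
Qed.

Lemma initial_exchange : base_exchange initial_bases.
Proof.
move=> B1 B2; rewrite !inE => /andP[hB1 /forall_inP m1] /andP[hB2 /forall_inP m2].
move=> e eD; have [f fD /andP[h1 h2]] := symmetric_exchange hB1 hB2 eD.
exists f => //; move: eD fD; rewrite !inE => /andP[eN2 e1] /andP[fN1 f2].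
have S1 : \sum_(b in f |: (B1 :\ e)) w b + w e = \sum_(b in B1) w b + w f.
  rewrite big_setU1 ?inE ?(negPf fN1) ?andbF //= (big_setD1 e e1) /=.
  by rewrite addrAC [RHS]addrAC [w e + w f]addrC.
have S2 : \sum_(b in e |: (B2 :\ f)) w b + w f = \sum_(b in B2) w b + w e.
  rewrite big_setU1 ?inE ?(negPf eN2) ?andbF //= (big_setD1 f f2) /=.
  by rewrite addrAC [RHS]addrAC [w f + w e]addrC.
have ef : w e <= w f.
  by rewrite -(lerD2l (\sum_(b in B2) w b)) -S2 lerD2r m2.
rewrite h1; apply/forall_inP => B' hB'; apply: le_trans (m1 _ hB') _.
by rewrite -(lerD2r (w e)) S1 lerD2l.
Qed.

Definition initial : matroid E := Matroid initial_n0 initial_exchange.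

End InitialMatroid.

Section FreeMatroid.
Variable E : finType.

Lemma free_n0 : [set [set: E]] != set0 :> {set {set E}}.
Proof. by apply/set0Pn; exists setT; rewrite inE. Qed.

Lemma free_exchange : base_exchange [set [set: E]].
Proof. by move=> B1 B2 /set1P-> /set1P-> e; rewrite setDv inE. Qed.

Definition free_matroid : matroid E := Matroid free_n0 free_exchange.

End FreeMatroid.

(* Imported only now: classical_sets shadows the names of finset lemmas. *)
From mathcomp Require Import all_classical all_reals all_analysis.
From Stdlib Require Import Relation_Operators.
Import numFieldNormedType.Exports.

Section Bergman.
Variables (R : realType) (E : finType) (M : matroid E).

Definition Berg : set {ffun E -> R} := [set w |
  forall C, circuit M C -> exists i j,
    [/\ i \in C, j \in C, i != j, w i = w j
      & forall k, k \in C -> w i <= w k]]%classic.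

Definition apartment (B : {set E}) : set {ffun E -> R} :=
  [set w | Berg w /\ B \in bases (initial M w)]%classic.

End Bergman.

Section Pushforward.
Variables (R : realType) (E1 E2 : finType).
Variables (M1 : matroid E1) (M2 : matroid E2) (phi : E1 -> E2).

Definition extension :=
  [/\ injective phi,
      rk M1 [set: E1] = rk M2 [set: E2]
    & forall B : {set E1},
        (B \in bases M1) = restr_basis M2 (phi @: [set: E1]) (phi @: B)].

Definition pushforward (w : {ffun E1 -> R}) : {ffun E2 -> R} :=
  [ffun e => sup [set t : R |
     e \in span M2 (phi @: [set i | (t <= w i)%R]%SET)]%classic].

End Pushforward.

Section PermutahedralFan.
Variables (R : realType) (m : nat).
Local Notation V := {ffun 'I_m -> R}.
Local Notation L := {ffun 'I_m -> int}.

Definition pairing (u : L) (x : V) : R := \sum_j (u j)%:~R * x j.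

Definition perm_cone (s : 'S_m) : set V :=
  [set w | forall i j : 'I_m, (i <= j)%N -> w (s j) <= w (s i)]%classic.

(* For j = i + 1, the facet of perm_cone s shared with the maximal cone
   obtained from s by exchanging the positions i and j. *)
Definition wall (s : 'S_m) (i j : 'I_m) : set V :=
  [set w | perm_cone s w /\ w (s i) = w (s j)]%classic.

Lemma wallE (s : 'S_m) (i j : 'I_m) : j = i.+1 :> nat ->
  wall s i j = (perm_cone s `&` perm_cone (tperm i j * s)%g)%classic.
Proof.
move=> ij; have leij : (i <= j)%N by rewrite ij.
apply/seteqP; split=> w /=.
  move=> [ws wij]; split=> // k l kl; rewrite !permM.
  have wt p : w (s (tperm i j p)) = w (s p) by case: tpermP => [->|->|].
  by rewrite !wt; apply: ws.
move=> [ws wt]; split=> //; apply/eqP; rewrite eq_le (ws _ _ leij) andbT.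
by have := wt _ _ leij; rewrite !permM tpermL tpermR.
Qed.

(* For a convex cone C the differences a - b of its points form its linear
   span, so this is the interior of C relative to that span. *)
Definition relint (C : set V) : set V :=
  [set x | C x /\ exists2 eps : R, 0 < eps & forall a b, C a -> C b ->
     (forall k, `|a k - b k - x k| < eps) -> C (a - b)]%classic.

Definition primitive_normal (tau sigma : set V) (eta : L) :=
  (forall u : L, (forall x, tau x -> pairing u x = 0) <->
                 exists k : int, u = eta *~ k) /\
  (forall x, sigma x -> 0 <= pairing eta x).

Lemma wall_primitive_normal (s : 'S_m) (i j : 'I_m) :
  j = i.+1 :> nat ->
  primitive_normal (wall s i j) (perm_cone s)
    [ffun k => (k == s i)%:R - (k == s j)%:R].
Proof.
move=> ij; set eta := [ffun k => _].
have ltij : (i < j)%N by rewrite ij.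
have etaE (x : {ffun 'I_m -> R}) : pairing eta x = x (s i) - x (s j).
  rewrite /pairing.
  under eq_bigr => k _ do rewrite ffunE rmorphB mulrBl.
  rewrite sumrB (bigD1 (s i)) //= [X in _ - X](bigD1 (s j)) //= !eqxx !mul1r.
  rewrite !big1 ?addr0 // => k /negPf kN; rewrite kN mul0r //.
split; last by move=> x sx; rewrite etaE subr_ge0; apply: sx; apply: ltnW.
move=> u; split; last first.
  move=> [k ->] x [sx xij]; rewrite /pairing.
  have -> : \sum_l ((eta *~ k) l)%:~R * x l = k%:~R * pairing eta x.
    rewrite mulr_sumr; apply: eq_bigr => l _.
    by rewrite ffunMzE -[eta l *~ k]mulrzr intz intrM mulrAC mulrC.
  by rewrite etaE xij subrr mulr0.
move=> u0; pose U l := u (s l).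
pose P (k : nat) : int := \sum_(l < m | (l < k)%N) U l.
have P0 k : (k != i.+1)%N -> P k = 0.
  move=> ki; pose p : {ffun 'I_m -> R} := [ffun l => ((s^-1)%g l < k)%N%:R].
  have wp : wall s i j p.
    split=> [a b ab|]; rewrite !ffunE !permK ?ler_nat.
      by case: (ltnP b k) => // bk; rewrite (leq_ltn_trans ab bk).
    by rewrite ij [in RHS]ltn_neqAle eq_sym ki.
  have := u0 p wp; rewrite /pairing (reindex_inj (@perm_inj _ s)) /=.
  under eq_bigr => l _ do rewrite ffunE permK.
  move/eqP; have -> : \sum_(l < m) (u (s l))%:~R * (l < k)%N%:R = (P k)%:~R :> R.
    rewrite rmorph_sum [RHS]big_mkcond /=; apply: eq_bigr => l _.
    by case: ifP; rewrite ?mulr1 ?mulr0.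
  by rewrite intr_eq0 => /eqP.
have UP (l : 'I_m) : P l.+1 = U l + P l.
  rewrite /P (bigD1 l) //=; congr (_ + _); apply: eq_bigl => k.
  by rewrite ltnS [RHS]ltn_neqAle andbC.
exists (U i); apply/ffunP => k; rewrite ffunMzE ffunE -[k](permKV s).
move: ((s^-1)%g k) => {}k; rewrite !(inj_eq perm_inj) -/(U k).
have := UP k; have [->|ki] := eqVneq k i.
  have -> : (i == j) = false.
    by apply/negP => /eqP eij; rewrite eij ltnn in ltij.
  by rewrite subr0 intz.
have [->|kj] := eqVneq k j.
  rewrite (P0 j.+1); last by rewrite eqSS ij gtn_eqF.
  have := UP i; rewrite (P0 i) ?ltn_eqF // addr0 -ij => ->.
  by rewrite sub0r mulNrz intz => /esym/eqP; rewrite addr_eq0 => /eqP.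
rewrite subrr mul0rz !P0 ?addr0 //.
by rewrite -ij; exact: kj.
Qed.

Definition integral_point (E : finType) (x : {ffun E -> R}) :=
  forall e, x e \is a Num.int.

Definition tautological (M : matroid 'I_m) (w : V) : {ffun 'I_m -> R} :=
  [ffun e => sup [set k : R |
     e \in span M [set j | (k <= w j)%R]%SET]%classic].

Section GlobalGeneration.
Variables (E : finType) (M : matroid E) (Phi : V -> {ffun E -> R}).

Definition H0 (u : L) : {set E} :=
  [set e | `[< forall x, pairing u x <= Phi x e >]]%SET.

Definition fib (s : 'S_m) (u : L) : {set E} :=
  [set e | `[< forall x, perm_cone s x -> pairing u x <= Phi x e >]]%SET.

Definition fib_gt (s : 'S_m) (u : L) : {set E} :=
  span M [set e | `[< exists u' : L,
    [/\ u' != u, forall x, perm_cone s x -> pairing u x <= pairing u' x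
      & e \in fib s u'] >]]%SET.

(* A basis of the direct sum over u of the minors fib s u / fib_gt s u, as a
   subset of the disjoint union of their ground sets. *)
Definition fiber_basis (s : 'S_m) (S : set (E * L)) :=
  forall u, exists2 B : {set E}, minor_basis M (fib s u) (fib_gt s u) B &
    forall e, S (e, u) <-> e \in B.

Definition globally_generated :=
  forall s : 'S_m, exists2 S : set (E * L), fiber_basis s S &
    forall e u, S (e, u) -> e \in H0 u /\ e \notin fib_gt s u.

End GlobalGeneration.

Record curve_bundle := CurveBundle {
  cb_ground : finType;
  cb_matroid : matroid cb_ground;
  cb_map : V -> {ffun cb_ground -> R}
}.

Section Curve.
Variable eta : L.

Definition linear_into_apartment (b : curve_bundle) (H : set V) :=
  exists2 B, B \in bases (cb_matroid b) &
    (forall x, H x -> apartment (cb_matroid b) B (cb_map b x)) /\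
    (forall e, e \in B -> exists c : V, forall x, H x ->
       cb_map b x e = \sum_j c j * x j).

Definition is_curve_bundle (b : curve_bundle) :=
  [/\ loopfree (cb_matroid b),
      forall x, Berg (cb_matroid b) (cb_map b x),
      forall x, integral_point x -> integral_point (cb_map b x),
      linear_into_apartment b [set x | 0 <= pairing eta x]%classic
    & linear_into_apartment b [set x | pairing eta x <= 0]%classic].

Definition bundle_extension (b1 b2 : curve_bundle) :=
  [/\ is_curve_bundle b1, is_curve_bundle b2
    & exists2 phi : cb_ground b1 -> cb_ground b2,
        extension (cb_matroid b1) (cb_matroid b2) phi &
        forall y, cb_map b2 y = pushforward (cb_matroid b2) phi (cb_map b1 y)].

Definition bundle_equiv : curve_bundle -> curve_bundle -> Prop :=
  clos_refl_sym_trans curve_bundle bundle_extension.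

(* A line bundle O(a) is given by its only coordinate function f. *)
Definition line_bundle_map (a : int) (f : V -> R) :=
  exists up um : L,
    [/\ up - um = eta *~ a,
        forall x, 0 <= pairing eta x -> f x = pairing up x
      & forall x, pairing eta x <= 0 -> f x = pairing um x].

Definition sum_line_bundles (r : nat) (a : 'I_r -> int) (b : curve_bundle) :=
  exists2 Psi : V -> {ffun 'I_r -> R},
    (forall j, line_bundle_map (a j) (fun x => Psi x j)) &
    b = CurveBundle (free_matroid 'I_r) Psi.

End Curve.

Section Nef.
Variables (E : finType) (M : matroid E) (Phi : V -> {ffun E -> R}).

Definition restriction (x : V) : curve_bundle :=
  @CurveBundle E (initial M (Phi x)) (fun y => [ffun e =>
    lim ((fun eps : R => (Phi (x + eps *: y) e - Phi x e) / eps)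
           @ at_right (0 : R))%classic]).

Definition nef :=
  forall (s : 'S_m) (i j : 'I_m) (eta : L) (x : V),
    j = i.+1 :> nat ->
    primitive_normal (wall s i j) (perm_cone s) eta ->
    relint (wall s i j) x ->
    exists r (a : 'I_r -> int) (b : curve_bundle),
      [/\ forall k, 0 <= a k,
          sum_line_bundles eta a b
        & bundle_equiv eta (restriction x) b].

End Nef.

End PermutahedralFan.

(* Main.v *)
From mathcomp Require Import all_boot all_order all_algebra all_fingroup zify lra.
Require Import Defs.

(** Let s be a permutation and order the ground set by it. The elements that do
    not depend on their predecessors form the greedy basis of s, and every
    element e has a leader, the last element of the shortest initial segment
    spanning e, which lies in the greedy basis. On the cone of s the superlevel
    sets of a point are initial segments, so there the tautological map Phi is
    the linear map that sends x to the family of the coordinates of x at the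
    leaders ([tautologicalE]).

    Global generation. On the cone of s the only characters for which the
    filtration by the flats F_u jumps are thus the unit forms of the greedy
    elements b, where it jumps from the span of the elements before b to the
    span of those up to b ([fib_unit], [fib_gt_unit]). The fiber therefore has
    the basis formed by the greedy elements, each placed in the degree of its
    own unit form, and these are global sections since x_b <= Phi(x)_b
    everywhere.

    Nefness. Call a weight w adapted to a basis B when each superlevel set of w
    is spanned by the part of B in it. Such a w lies in the Bergman fan and in
    the apartment of B ([adapted_Berg], [adapted_initial]), and it is the
    pushforward of its restriction to B. So a map into weights that are all
    adapted to one basis B, and linear on both half-spaces, is equivalent to
    the direct sum of its coordinates in B ([basis_extension]). It remains to
    see that the restriction to the curve of a wall is of this kind for the
    greedy basis B of one of the two adjacent cones. First, Phi takes on both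
    cones values adapted to B ([adapted_tautological]): this is the one point
    where the matroid structure around the wall enters. Secondly, adaptedness
    to B passes from a weight and a nearby weight to the direction between them
    in the initial matroid ([adapted_initial_dir]), which turns the values of
    Phi near the wall into values of the limit map. Finally, a coordinate in B
    has degree 0 unless its leader changes across the wall; then it is the
    maximum of the two exchanged coordinates, of degree 1
    ([greedy_leader_across]). *)

Set Implicit Arguments.
Unset Strict Implicit.
Unset Printing Implicit Defensive.

Import Order.TTheory GRing.Theory Num.Theory.

Local Open Scope ring_scope.

(** * Rank and closure in a matroid given by its bases *)

Section Closure.
Variables (E : finType) (M : matroid E).
Implicit Types (A B I J : {set E}) (e f : E).

Lemma indep_sub I J : indep M J -> I \subset J -> indep M I.
Proof.
move=> /existsP[B /andP[hB JB]] IJ; apply/existsP; exists B.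
by rewrite hB (subset_trans IJ).
Qed.

Lemma base_indep B : B \in bases M -> indep M B.
Proof. by move=> hB; apply/existsP; exists B; rewrite hB /=. Qed.

Lemma rk_ge A B : B \in bases M -> (#|B :&: A| <= rk M A)%N.
Proof. by move=> hB; rewrite /rk (bigD1 B) //= leq_maxl. Qed.

Lemma rk_attained A : exists2 B, B \in bases M & rk M A = #|B :&: A|.
Proof.
have [|B hB rkA] := @eq_bigmax_cond _ (mem (bases M)) (fun B => #|B :&: A|).
  by rewrite card_gt0 bases_n0.
by exists B.
Qed.

Lemma card_indep_le I A : indep M I -> I \subset A -> (#|I| <= rk M A)%N.
Proof.
move=> /existsP[B /andP[hB IB]] IA; apply: leq_trans (rk_ge A hB).
by rewrite subset_leq_card // subsetI IB.
Qed.

Lemma rk_mono A A' : A \subset A' -> (rk M A <= rk M A')%N.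
Proof.
move=> sA; have [B hB ->] := rk_attained A; apply: leq_trans (rk_ge A' hB).
by rewrite subset_leq_card // setIS.
Qed.

Lemma rk_indep I : indep M I -> rk M I = #|I|.
Proof.
move=> iI; apply/eqP; rewrite eqn_leq card_indep_le ?andbT //.
by have [B _ ->] := rk_attained I; rewrite subset_leq_card // subsetIr.
Qed.

Lemma rkU1_le A e : (rk M (e |: A) <= (rk M A).+1)%N.
Proof.
have [B hB ->] := rk_attained (e |: A).
apply: (@leq_trans #|e |: (B :&: A)|).
  apply/subset_leq_card/subsetP => x; rewrite !inE => /andP[-> /orP[->//|->]].
  by rewrite orbT.
by rewrite cardsU1 -add1n leq_add ?leq_b1 // rk_ge.
Qed.

(** Extending I inside the union of I and a basis that meets A in rk A elements
    loses nothing in A, since outside A it can only remove elements. *)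
Lemma indep_augment I A : indep M I -> I \subset A ->
  exists J, [/\ indep M J, I \subset J, J \subset A & #|J| = rk M A].
Proof.
move=> iI IA; have [B hB rkA] := rk_attained A.
have [B' hB' /andP[IB' B'IB]] := indep_extend iI hB.
exists (B' :&: A); split.
- by apply: indep_sub (base_indep hB') (subsetIl _ _).
- by rewrite subsetI IB'.
- exact: subsetIr.
apply/eqP; rewrite eqn_leq rk_ge //= rkA.
rewrite -(leq_add2r #|B' :\: A|) cardsID (bases_card hB' hB) -(cardsID A B).
rewrite leq_add2l; apply/subset_leq_card/subsetP => x; rewrite !inE.
move=> /andP[xA xB']; rewrite xA /=; have := subsetP B'IB _ xB'.
by rewrite inE => /orP[/(subsetP IA)|//]; rewrite (negPf xA).
Qed.

(** A closure can be computed from any maximal independent subset, for which it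
    is described by independence alone; the closure axioms are derived from
    this. *)
Lemma span_max_indep A I e : indep M I -> I \subset A -> #|I| = rk M A ->
  (e \in span M A) = (e \in I) || ~~ indep M (e |: I).
Proof.
move=> iI IA cI; rewrite inE; apply/eqP/orP => [rkE|].
  have [eI|eI] := boolP (e \in I); [by left|right].
  apply/negP => iI'; have : (#|e |: I| <= rk M (e |: A))%N.
    by apply: card_indep_le => //; apply: setUS.
  by rewrite rkE cardsU1 eI cI ltnn.
move=> eI; apply/eqP; rewrite eqn_leq (rk_mono (subsetUr _ _)) andbT leqNgt.
apply/negP => lt; case: eI => [eI|/negP nI].
  by move: lt; rewrite (setUidPr _) ?ltnn // sub1set (subsetP IA).
have [J [iJ IJ JA cJ]] := indep_augment iI (subset_trans IA (subsetUr [set e] A)).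
have [eJ|eJ] := boolP (e \in J).
  by apply: nI; apply: indep_sub iJ _; rewrite subUset sub1set eJ.
move: lt; rewrite -cJ ltnNge card_indep_le //.
apply/subsetP => x xJ; have := subsetP JA _ xJ.
by rewrite !inE => /orP[/eqP xe|//]; rewrite -xe xJ in eJ.
Qed.

Lemma span_indep I e : indep M I ->
  (e \in span M I) = (e \in I) || ~~ indep M (e |: I).
Proof. by move=> iI; apply: span_max_indep; rewrite ?rk_indep. Qed.

Lemma indepU1 I e : indep M I -> e \notin span M I -> indep M (e |: I).
Proof. by move=> iI; rewrite span_indep // negb_or negbK => /andP[]. Qed.

Lemma indep0 : indep M set0.
Proof.
by have [B hB] := set0Pn _ (bases_n0 M); apply: indep_sub (base_indep hB) (sub0set _).
Qed.

Lemma max_indep A : exists I, [/\ indep M I, I \subset A & #|I| = rk M A].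
Proof. by have [I [? _ ? ?]] := indep_augment indep0 (sub0set A); exists I. Qed.

Lemma sub_span A : A \subset span M A.
Proof. by apply/subsetP => e eA; rewrite inE (setUidPr _) // sub1set. Qed.

Lemma span_mono A A' : A \subset A' -> span M A \subset span M A'.
Proof.
move=> sA; have [I [iI IA cI]] := max_indep A.
have [J [iJ IJ JA cJ]] := indep_augment iI (subset_trans IA sA).
apply/subsetP => e; rewrite (span_max_indep e iI IA cI).
rewrite (span_max_indep e iJ JA cJ) => /orP[eI|nI].
  by rewrite (subsetP IJ).
by rewrite (contra _ nI) ?orbT // => iJ'; apply: indep_sub iJ' (setUS _ IJ).
Qed.

Lemma span_id A : span M (span M A) = span M A.
Proof.
have [I [iI IA cI]] := max_indep A.
have IsA : I \subset span M A := subset_trans IA (sub_span A).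
suff cI' : #|I| = rk M (span M A).
  by apply/setP => e; rewrite (span_max_indep e iI IsA cI') (span_max_indep e iI IA cI).
have [J [iJ IJ JA <-]] := indep_augment iI IsA.
suff -> : J = I by [].
apply/eqP; rewrite eqEsubset IJ andbT; apply/subsetP => e eJ.
have := subsetP JA _ eJ; rewrite (span_max_indep e iI IA cI) => /orP[//|/negP[]].
by apply: indep_sub iJ _; rewrite subUset sub1set eJ.
Qed.

Lemma span_sub A A' : A \subset span M A' -> span M A \subset span M A'.
Proof. by move/span_mono; rewrite span_id. Qed.

(** The rank of A together with e and f is at most rk A + 1 by the first
    hypothesis, and e alone already attains this by the second. *)
Lemma span_exchange A e f :
  e \in span M (f |: A) -> e \notin span M A -> f \in span M (e |: A).
Proof.
rewrite !inE => /eqP rkef ne; rewrite setUCA; apply/eqP/eqP.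
rewrite eqn_leq [X in _ && X]rk_mono ?andbT; last first.
  by apply/subsetP => x; rewrite !inE => /orP[->|->]; rewrite ?orbT.
rewrite rkef; apply: leq_trans (rkU1_le A f) _.
by rewrite ltn_neqAle eq_sym ne rk_mono // subsetUr.
Qed.

Lemma span_base B e : B \in bases M -> e \in span M B.
Proof.
move=> hB; rewrite (span_indep e (base_indep hB)).
have [//|eB] := boolP (e \in B); apply/negP => /existsP[B' /andP[hB' sB]].
by move: (subset_leq_card sB); rewrite cardsU1 eB (bases_card hB hB') ltnn.
Qed.

Lemma indep_span_base B : indep M B -> span M B = setT -> B \in bases M.
Proof.
move=> /existsP[B' /andP[hB' BB']] sB; suff <- : B' = B by [].
apply/eqP; rewrite eqEsubset BB' andbT; apply/subsetP => e eB'.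
have := in_setT e; rewrite -sB (span_indep e (indep_sub (base_indep hB') BB')).
move=> /orP[//|/negP[]]; apply: indep_sub (base_indep hB') _.
by rewrite subUset sub1set eB'.
Qed.

Lemma loopfree_span0 : loopfree M -> span M set0 = set0.
Proof.
move=> lf; apply/setP => e; rewrite span_indep ?indep0 // inE setU0.
by rewrite (lf e).
Qed.

Lemma restr_basis_span (F I : {set E}) :
  indep M I -> I \subset F -> F \subset span M I -> restr_basis M F I.
Proof.
move=> iI IF FI; apply/maxsetP; split; first by rewrite iI.
move=> J /andP[iJ JF] IJ; apply/eqP; rewrite eqEsubset IJ andbT.
apply/subsetP => e eJ; have := subsetP FI _ (subsetP JF _ eJ).
rewrite span_indep // => /orP[//|/negP[]].
by apply: indep_sub iJ _; rewrite subUset sub1set eJ.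
Qed.

Lemma span_subbase B A e : B \in bases M -> A \subset B -> e \in B ->
  (e \in span M A) = (e \in A).
Proof.
move=> hB AB eB; have iB := base_indep hB.
rewrite (span_indep e (indep_sub iB AB)) (indep_sub iB) ?orbF //.
by rewrite subUset sub1set eB.
Qed.

(** The elements b for which [B :\ b] can be completed by e form, together with
    e, the fundamental circuit of e, and e is spanned exactly by those subsets
    of B that contain all of them. *)
Lemma span_subbase_circuit B A e : B \in bases M -> A \subset B -> e \notin B ->
  reflect (forall b, b \in B -> e |: (B :\ b) \in bases M -> b \in A)
          (e \in span M A).
Proof.
move=> hB AB eB; have iA := indep_sub (base_indep hB) AB.
apply: (iffP idP) => [eA b bB hb|cA].
  apply: contraLR eA => bA; rewrite span_indep // negb_or negbK.
  rewrite (contra (subsetP AB e)) //=; apply: indep_sub (base_indep hb) _.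
  apply: setUS; apply/subsetP => x xA; rewrite !inE (subsetP AB) // andbT.
  by apply: contraNneq bA => <-.
apply: contraT => eNA.
have [B' hB' /andP[AB' B'A]] := indep_extend (indepU1 iA eNA) hB.
have eB' : e \in B' by rewrite (subsetP AB') ?setU11.
have B'eB : B' \subset e |: B.
  by apply: subset_trans B'A _; rewrite -setUA setUS // subUset AB /=.
have /subsetPn[b bB bB'] : ~~ (B \subset B').
  apply/negP => BB'; have : e |: B \subset B' by rewrite subUset sub1set eB'.
  by move/subset_leq_card; rewrite cardsU1 eB (bases_card hB hB') ltnn.
have B'E : B' = e |: (B :\ b).
  apply/eqP; rewrite eqEcard; apply/andP; split.
    apply/subsetP => x xB'; have := subsetP B'eB _ xB'.
    rewrite !inE => /orP[->//|->]; rewrite andbT orbC.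
    by rewrite (contraNneq _ bB') // => <-.
  rewrite cardsU1 !inE (negPf eB) andbF /= (bases_card hB' hB).
  by rewrite (cardsD1 b B) bB.
rewrite B'E in hB'; have bA := cA b bB hB'.
by case/negP: bB'; rewrite (subsetP AB') // setU1r.
Qed.

End Closure.

(** * Weights adapted to a basis *)

Section Adapted.
Variables (R : realDomainType) (E : finType).
Implicit Types (M : matroid E) (B : {set E}) (w : {ffun E -> R}) (e b : E).

(** The second condition says that the superlevel sets of w are the flats spanned
    by the corresponding parts of B; by [adapted_exchange] and
    [exchange_adapted] it amounts to w e being the minimum of w over the rest of
    the fundamental circuit of e, for each e outside B. *)
Definition adapted M B w :=
  B \in bases M /\
  forall e t, (t <= w e) = (e \in span M [set b in B | t <= w b]).

Lemma superlevel_sub B w t : [set b in B | t <= w b] \subset B.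
Proof. by apply/subsetP => b; rewrite inE => /andP[]. Qed.

Lemma adapted_exchange M B w e : adapted M B w -> e \notin B ->
  (forall b, b \in B -> e |: (B :\ b) \in bases M -> w e <= w b) /\
  (exists2 b, b \in B & (e |: (B :\ b) \in bases M) && (w b == w e)).
Proof.
move=> [hB lev] eB.
have lower b : b \in B -> e |: (B :\ b) \in bases M -> w e <= w b.
  move=> bB hb; have := lev e (w e).
  rewrite lexx => /esym/(span_subbase_circuit hB (superlevel_sub _ _ _) eB).
  by move/(_ b bB hb); rewrite inE => /andP[].
split=> //; apply/exists_inP; apply: contraT => /exists_inPn noeq.
pose C := [set b in B | e |: (B :\ b) \in bases M].
(* If all weights on the rest of the circuit exceed w e, so does t, and yet e
   is spanned by the elements of B of weight at least t. The default value
   gives the same contradiction when e is a loop. *)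
pose t := \big[Order.min/w e + 1]_(b in C) w b.
have : w e < t.
  apply/bigmin_gtP; split=> [|b]; first by rewrite ltrDl ltr01.
  rewrite inE => /andP[bB hb]; rewrite lt_neqAle lower // andbT eq_sym.
  by have := noeq b bB; rewrite hb.
rewrite ltNge lev => /negP[].
apply/(span_subbase_circuit hB (superlevel_sub _ _ _) eB) => b bB hb.
by rewrite inE bB bigmin_le_cond // inE bB.
Qed.

Lemma exchange_adapted M B w : B \in bases M ->
  (forall e, e \notin B ->
     (forall b, b \in B -> e |: (B :\ b) \in bases M -> w e <= w b) /\
     (exists2 b, b \in B & (e |: (B :\ b) \in bases M) && (w b == w e))) ->
  adapted M B w.
Proof.
move=> hB ex; split=> // e t; have [eB|eB] := boolP (e \in B).
  by rewrite (span_subbase hB) ?superlevel_sub // inE eB.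
have [lower [b bB /andP[hb /eqP wb]]] := ex e eB.
apply/idP/(span_subbase_circuit hB (superlevel_sub _ _ _) eB) => [te b' b'B hb'|c].
  by rewrite inE b'B (le_trans te) // lower.
by have := c b bB hb; rewrite inE wb => /andP[].
Qed.

Lemma adapted_lt M B w e t : adapted M B w ->
  (t < w e) = (e \in span M [set b in B | t < w b]).
Proof.
move=> aw; have [hB lev] := aw.
apply/idP/idP => [te|].
  have := lev e (w e); rewrite lexx => /esym; apply/subsetP/span_mono/subsetP => b.
  by rewrite !inE => /andP[-> /(lt_le_trans te)].
have ltB : [set b in B | t < w b] \subset B.
  by apply/subsetP => b; rewrite inE => /andP[].
have [eB|eB] := boolP (e \in B).
  by rewrite (span_subbase hB) // inE => /andP[].
have [_ [b bB /andP[hb /eqP<-]]] := adapted_exchange aw eB.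
by move/(span_subbase_circuit hB ltB eB)/(_ b bB hb); rewrite inE => /andP[].
Qed.

(** A loop lies in the span of every superlevel set, which would make its weight
    arbitrarily large. *)
Lemma adapted_loopfree M B w : adapted M B w -> loopfree M.
Proof.
move=> [hB lev] e; rewrite -[[set e]]setU0; apply: indepU1; first exact: indep0.
apply/negP => e0; have := lev e (w e + 1); rewrite gerDl ler10.
by move=> /esym/negP[]; apply: subsetP e0; apply/span_mono/sub0set.
Qed.

(** Exchanging an element of another basis for one of B never decreases the
    weight, so B is reached from any basis without loss. *)
Lemma adapted_initial M B w : adapted M B w -> B \in bases (initial M w).
Proof.
move=> [hB lev]; rewrite inE hB; apply/forall_inP => B'.
have [n] := ubnP #|B :\: B'|; elim: n B' => // n IHn B'.
rewrite ltnS => ltn hB'.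
have [BB'|/subsetPn[f fB fB']] := boolP (B \subset B').
  by have /eqP-> : B == B' by rewrite eqEcard BB' (bases_card hB hB') /=.
have fD : f \in B :\: B' by rewrite inE fB'.
have [e eD /andP[hBe hB'f]] := symmetric_exchange hB hB' fD.
move: eD; rewrite inE => /andP[eB eB'].
have wef : w e <= w f.
  have := lev e (w e); rewrite lexx => /esym.
  move=> /(span_subbase_circuit hB (superlevel_sub _ _ _) eB) /(_ f fB hBe).
  by rewrite inE => /andP[].
apply: (@le_trans _ _ (\sum_(b in f |: (B' :\ e)) w b)).
  rewrite big_setU1 ?inE ?(negPf fB') ?andbF //= (big_setD1 e eB') /=.
  by rewrite lerD2r.
apply: IHn hB'f; apply: leq_trans ltn; apply/proper_card/properP; split.
  apply/subsetP => x; rewrite !inE negb_or negb_and negbK.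
  move=> /andP[/andP[_ /orP[/eqP->|xB']] xB]; last by rewrite xB'.
  by rewrite xB in eB.
by exists f; rewrite ?inE ?fB' // eqxx.
Qed.

(** The star of a Bergman fan at w is the Bergman fan of the initial matroid:
    adapted directions are read off from adapted nearby points. Here wz is the
    nearby point w + eps w', and eps is small enough to preserve the strict
    inequalities between weights, so that an element of a fundamental circuit
    attaining the minimum for wz also attains it for w. *)
Lemma adapted_initial_dir M B (w w' wz : {ffun E -> R}) (eps : R) :
  0 < eps -> (forall e, wz e = w e + eps * w' e) ->
  (forall e b, w e < w b -> wz e < wz b) ->
  adapted M B w -> adapted M B wz -> adapted (initial M w) B w'.
Proof.
move=> eps0 wzE gap aw awz; have hB := adapted_initial aw.
have hM : B \in bases M by case: aw.
have swap e b : e \notin B -> b \in B ->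
    \sum_(x in e |: (B :\ b)) w x + w b = \sum_(x in B) w x + w e.
  move=> eB bB; rewrite big_setU1 ?inE ?(negPf eB) ?andbF //= (big_setD1 b bB) /=.
  by rewrite addrAC [RHS]addrAC [w e + _]addrC.
apply: exchange_adapted => // e eB.
have [lowz [b bB /andP[hb /eqP wb]]] := adapted_exchange awz eB.
have [low _] := adapted_exchange aw eB.
have eqw c : w c = w e -> (wz e <= wz c) = (w' e <= w' c).
  by move=> wce; rewrite !wzE wce lerD2l ler_pM2l.
split=> [c cB|].
  rewrite inE => /andP[hc /forall_inP/(_ B hM)].
  rewrite -(lerD2r (w c)) swap // lerD2l => wce.
  by rewrite -eqw ?lowz //; apply/eqP; rewrite eq_le wce low.
have wbe : w b = w e.
  apply/eqP; rewrite eq_le (low b bB hb) andbT leNgt; apply/negP => /gap.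
  by rewrite wb ltxx.
exists b => //; apply/andP; split.
  rewrite inE hb; apply/forall_inP => B' hB'.
  have : \sum_(x in B') w x <= \sum_(x in B) w x.
    by move: hB; rewrite inE => /andP[_ /forall_inP]; apply.
  by move/le_trans; apply; rewrite -(lerD2r (w b)) swap // wbe.
by move: wb; rewrite !wzE wbe => /addrI/(mulfI (lt0r_neq0 eps0))->.
Qed.

End Adapted.

(** Exchanging two neighbours i and j reverses the order of no other pair. *)
Lemma tperm_swap_lt m (i j a b : 'I_m) : j = i.+1 :> nat -> (a < b)%N ->
  (tperm i j b < tperm i j a)%N -> a = i /\ b = j.
Proof.
have neq (k l : 'I_m) : k <> l -> nat_of_ord k <> nat_of_ord l.
  by move=> kl /val_inj.
move=> ij; case: tpermP => [->|->|/neq bi /neq bj];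
  case: tpermP => [->|->|/neq ai /neq aj] //; lia.
Qed.

(** * The greedy basis of a linear order *)

Section Greedy.
Variables (m : nat) (M : matroid 'I_m) (s : 'S_m).
Hypothesis lfM : loopfree M.
Implicit Types (e f b x : 'I_m) (A : {set 'I_m}) (k : nat).

Definition place e : 'I_m := (s^-1)%g e.

Definition upto k : {set 'I_m} := [set e | (place e < k)%N].

(** The p-th element of the order, where the initial segment that ends with it is
    the shortest one spanning e; the place of e itself witnesses that such
    segments exist. *)
Definition leader e : 'I_m :=
  s [arg min_(p < place e | e \in span M (upto p.+1)) (p : nat)]%N.

Definition greedy : {set 'I_m} := [set b | leader b == b].

Lemma placeK e : s (place e) = e. Proof. exact: permKV. Qed.

Lemma place_perm p : place (s p) = p. Proof. exact: permK. Qed.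

Lemma place_inj e f : place e = place f :> nat -> e = f.
Proof. by move=> /val_inj/perm_inj. Qed.

Lemma upto_mono k l : (k <= l)%N -> upto k \subset upto l.
Proof. by move=> kl; apply/subsetP => x; rewrite !inE => /leq_trans; apply. Qed.

Lemma uptoS e : upto (place e).+1 = e |: upto (place e).
Proof.
apply/setP => x; rewrite !inE ltnS leq_eqVlt; congr (_ || _).
by apply/eqP/eqP => [/place_inj|->].
Qed.

Lemma upto_all : upto m = setT.
Proof. by apply/setP => x; rewrite !inE ltn_ord. Qed.

Lemma mem_span_upto e k : (e \in span M (upto k)) = (place (leader e) < k)%N.
Proof.
rewrite /leader place_perm; case: arg_minnP => [|p ep minp].
  by apply: (subsetP (sub_span _ _)); rewrite inE.
apply/idP/idP => [ek|pk]; last first.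
  by apply: subsetP ep; apply/span_mono/upto_mono.
rewrite ltnNge; apply/negP; case: k ek => [|k] ek kp.
  have u0 : upto 0 = set0 by apply/setP => x; rewrite !inE.
  by move: ek; rewrite u0 loopfree_span0 ?inE.
have := minp (Ordinal (ltn_trans kp (ltn_ord p))) ek.
by rewrite leqNgt kp.
Qed.

Lemma leader_le e : (place (leader e) <= place e)%N.
Proof.
by rewrite -ltnS -mem_span_upto; apply: (subsetP (sub_span _ _)); rewrite inE.
Qed.

Lemma greedyE b : (b \in greedy) = (b \notin span M (upto (place b))).
Proof.
rewrite mem_span_upto -leqNgt inE; apply/eqP/idP => [->//|le].
by apply/place_inj/eqP; rewrite eqn_leq leader_le.
Qed.

Lemma leader_greedy e : leader e \in greedy.
Proof.
rewrite greedyE; set f := leader e; apply/negP => ff.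
have : e \in span M (upto (place f).+1) by rewrite mem_span_upto.
rewrite uptoS => ef; have : e \in span M (upto (place f)).
  by apply: subsetP ef; apply: span_sub; rewrite subUset sub1set ff sub_span.
by rewrite mem_span_upto ltnn.
Qed.

(** Adding the next element to an initial segment either enlarges the greedy part
    by an independent element or does not enlarge the span. *)
Lemma greedy_upto k :
  indep M (greedy :&: upto k) /\ upto k \subset span M (greedy :&: upto k).
Proof.
elim: k => [|k [indk subk]].
  have -> : upto 0 = set0 by apply/setP => x; rewrite !inE.
  by rewrite setI0 indep0 sub0set.
case: (ltnP k m) => [km|mk]; last first.
  suff -> : upto k.+1 = upto k by [].
  by apply/setP => x; rewrite !inE !(leq_trans (ltn_ord _)) // ltnW.
have [f fk] : exists f, place f = k :> nat.
  by exists (s (Ordinal km)); rewrite place_perm.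
rewrite -{}fk in indk subk *; rewrite uptoS setIUr.
have [fG|fG] := boolP (f \in greedy).
  have -> : greedy :&: [set f] = [set f] by apply/setIidPr; rewrite sub1set.
  split.
    apply: indepU1 => //; rewrite greedyE in fG; apply: contra fG.
    by apply/subsetP/span_mono/subsetIr.
  rewrite subUset (subset_trans (subset_trans subk (span_mono _ (subsetUr [set f] _)))) //.
  by rewrite sub1set (subsetP (sub_span _ _)) // setU11.
have -> : greedy :&: [set f] = set0.
  by apply/eqP; rewrite setI_eq0 disjoint_sym disjoints1.
rewrite set0U; split=> //; rewrite subUset subk sub1set andbT.
by rewrite greedyE negbK in fG; apply: subsetP fG; apply: span_sub.
Qed.

Lemma greedy_base : greedy \in bases M.
Proof.
have [iG sG] := greedy_upto m; rewrite upto_all setIT in iG sG.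
by apply: indep_span_base => //; apply/eqP; rewrite -subTset.
Qed.

(** The greedy basis of s spans not only the flats of the initial segments of s
    but also those of the order in which the neighbours i and j = i + 1 are
    exchanged; the hypothesis covers initial segments A of both orders. In the
    second case A may contain the element s j, outside the basis, without
    containing s i; then s j depends on the elements before both, or s i belongs
    to the basis and to the span of A. *)
Lemma greedy_span (i j : 'I_m) A : j = i.+1 :> nat ->
  (forall e x, e \in A -> (place x < place e)%N ->
     x \in A \/ place x = i /\ place e = j) ->
  span M (greedy :&: span M A) = span M A.
Proof.
move=> ij down; set D := span M (greedy :&: _).
apply/eqP; rewrite eqEsubset span_sub ?subsetIr //=; apply: span_sub.
have uptoD k : upto k \subset A -> upto k \subset D.
  move=> kA; apply: subset_trans (greedy_upto k).2 (span_mono _ _).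
  by rewrite setIS // (subset_trans kA) // sub_span.
apply/subsetP => e eA.
have [eG|eG] := boolP (e \in greedy).
  by apply: (subsetP (sub_span _ _)); rewrite inE eG (subsetP (sub_span _ _)).
rewrite greedyE negbK in eG.
have [/uptoD/span_sub/subsetP->//|/subsetPn[a]] := boolP (upto (place e) \subset A).
rewrite inE => ae aA; have [/idPn//|[ai ej]] := down e a eA ae.
(* Here e = s j and a = s i, with the elements before a lying in A: either e
   depends on those, or a and e are exchangeable over them. *)
have iA : upto i \subset A.
  apply/subsetP => x; rewrite inE => xi.
  have xe : (place x < place e)%N by rewrite ej ij leqW.
  have [//|[xi' _]] := down e x eA xe.
  by rewrite xi' ltnn in xi.
have eE : upto (place e) = a |: upto i by rewrite ej ij -ai uptoS.
have [ei|ei] := boolP (e \in span M (upto i)).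
  by apply: subsetP ei; apply/span_sub/uptoD.
rewrite eE in eG; have aDA : a \in greedy :&: span M A.
  rewrite inE greedyE ai; apply/andP; split.
    apply: contra ei => ai'; apply: subsetP eG; apply: span_sub.
    by rewrite subUset sub1set ai' sub_span.
  have := span_exchange eG ei; apply/subsetP/span_mono.
  by rewrite subUset sub1set eA.
apply: subsetP eG; apply: span_sub; rewrite subUset sub1set uptoD //.
by rewrite (subsetP (sub_span _ _)).
Qed.

End Greedy.

From mathcomp Require Import all_classical all_reals all_analysis.
From mathcomp Require Import fintype finset.
From Stdlib Require Import Relation_Operators.
Require Import Defs.
Import numFieldNormedType.Exports.

(** * Bundles on a toric curve that are adapted to a basis *)

Section AdaptedBergman.
Variables (R : realType) (E : finType) (M : matroid E).
Implicit Types (B : {set E}) (w : {ffun E -> R}).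

(** If the minimum of w on a circuit C were attained only at i, then C without i,
    and hence i, would lie in the flat spanned by the elements of B of weight
    above w i. *)
Lemma adapted_Berg B w : adapted M B w -> Berg M w.
Proof.
move=> aw C circC; have [depC minC] := minsetP circC.
have /set0Pn[i0 i0C] : C != set0.
  by apply: contraNneq depC => ->; apply: indep0.
case: (@Order.TotalTheory.arg_minP _ _ _ i0 (mem C) w i0C) => i /= iC mini.
have {}iC : i \in C by [].
have [/exists_inP[j jCi /eqP wji]|/exists_inPn noeq] :=
    boolP [exists j in C :\ i, w j == w i].
  by move: jCi; rewrite !inE => /andP[ji jC]; exists i, j; split; rewrite // eq_sym.
have indCi : indep M (C :\ i).
  apply: contraT => dep; have := minC _ dep (subD1set _ _).
  by move=> CiC; move: iC; rewrite -CiC !inE eqxx.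
have : i \in span M (C :\ i).
  by rewrite span_indep // setD1K // depC orbT.
have CiS : C :\ i \subset span M [set b in B | w i < w b]%SET.
  apply/subsetP => f fC; rewrite -(adapted_lt _ _ aw) lt_neqAle eq_sym noeq //=.
  by apply: mini; move: fC; rewrite !inE => /andP[].
move=> /(subsetP (span_sub CiS)).
by rewrite -(adapted_lt _ _ aw) ltxx.
Qed.

End AdaptedBergman.

Section AdaptedCurve.
Variables (R : realType) (m : nat) (eta : {ffun 'I_m -> int}).
Local Notation V := {ffun 'I_m -> R}.

Lemma adapted_curve_bundle (b : curve_bundle R m) B :
  (forall y, adapted (cb_matroid b) B (cb_map b y)) ->
  (forall y, integral_point y -> integral_point (cb_map b y)) ->
  (forall e, exists c : V, forall y, 0 <= pairing eta y ->
     cb_map b y e = \sum_j c j * y j) ->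
  (forall e, exists c : V, forall y, pairing eta y <= 0 ->
     cb_map b y e = \sum_j c j * y j) ->
  is_curve_bundle eta b.
Proof.
move=> ab intb linp linm; have hB : B \in bases (cb_matroid b) by case: (ab 0).
split=> //.
- exact: adapted_loopfree (ab 0).
- by move=> y; apply: adapted_Berg (ab y).
- exists B => //; split=> [y _|e _]; last exact: linp.
  by split; [apply: adapted_Berg (ab y)|apply: adapted_initial].
- exists B => //; split=> [y _|e _]; last exact: linm.
  by split; [apply: adapted_Berg (ab y)|apply: adapted_initial].
Qed.

Lemma adapted_free (E : finType) (w : {ffun E -> R}) :
  adapted (free_matroid E) setT w.
Proof. by apply: exchange_adapted => [|e]; rewrite ?set11 // inE. Qed.

Lemma sup_lower_ray (a : R) : sup [set t : R | t <= a]%classic = a.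
Proof.
apply/eqP; rewrite eq_le; apply/andP; split.
  by apply: ge_sup => //; exists a => /=.
by apply: ub_le_sup; [exists a|exact: lexx].
Qed.

(** The coordinates in B determine an adapted map, so that restricting to B
    gives an extension of matroids along which the map is a pushforward. *)
Lemma basis_extension (E : finType) (M : matroid E) (B : {set E})
    (Psi : V -> {ffun E -> R}) :
  (forall y, adapted M B (Psi y)) ->
  (forall y, integral_point y -> integral_point (Psi y)) ->
  (forall e, exists c : V, forall y, 0 <= pairing eta y ->
     Psi y e = \sum_j c j * y j) ->
  (forall e, exists c : V, forall y, pairing eta y <= 0 ->
     Psi y e = \sum_j c j * y j) ->
  bundle_extension eta
    (CurveBundle (free_matroid 'I_#|B|)
       (fun y => [ffun k => Psi y (enum_val k)]))
    (CurveBundle M Psi).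
Proof.
move=> aPsi intPsi linp linm; have hB : B \in bases M by case: (aPsi 0).
have imB : [set enum_val k | k in [set: 'I_#|B|]]%SET = B.
  apply/setP => e; apply/imsetP/idP => [[k _ ->]|eB]; first exact: enum_valP.
  by exists (enum_rank_in eB e); rewrite ?enum_rankK_in ?inE.
have level (w : {ffun E -> R}) (v : {ffun 'I_#|B| -> R}) t :
    v = [ffun k => w (enum_val k)] ->
    [set enum_val k | k in [set k | t <= v k]]%SET = [set b in B | t <= w b]%SET.
  move=> ->; apply/setP => e; rewrite inE; apply/imsetP/andP => [[k]|[eB te]].
    by rewrite inE ffunE => tk ->; rewrite enum_valP.
  by exists (enum_rank_in eB e); rewrite ?inE ?ffunE enum_rankK_in.
have freeE A : (A \in bases (free_matroid 'I_#|B|)) = (A == setT).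
  by rewrite /= inE.
split; last exists enum_val; last 1 first.
- move=> y; apply/ffunP => e; rewrite /= [RHS]ffunE -[LHS]sup_lower_ray.
  congr (reals.sup _); apply/seteqP; have [_ lev] := aPsi y.
  by split=> t /=; rewrite (level (Psi y)) // lev.
- set b1 := CurveBundle (free_matroid _) _.
  apply: (@adapted_curve_bundle b1 [set: 'I_#|B|]%SET) => /=.
  + by move=> y; apply: adapted_free.
  + by move=> y iy k; rewrite ffunE; apply: intPsi.
  + by move=> k; have [c hc] := linp (enum_val k); exists c => y /hc; rewrite ffunE.
  + by move=> k; have [c hc] := linm (enum_val k); exists c => y /hc; rewrite ffunE.
- exact: (@adapted_curve_bundle (CurveBundle M Psi) B).
split=> /= [||A]; first exact: enum_val_inj.
  have rkT (E' : finType) (M' : matroid E') B' : B' \in bases M' ->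
      rk M' [set: E'] = #|B'|.
    move=> hB'; have [B1 hB1 ->] := rk_attained M' setT.
    by rewrite setIT (bases_card hB1 hB').
  by rewrite (rkT _ _ _ hB) (rkT _ _ setT) ?freeE // cardsT card_ord.
rewrite freeE imB; apply/eqP/idP => [->|].
  by rewrite imB; apply: restr_basis_span; rewrite ?base_indep ?sub_span.
move=> /maxsetP[_ maxA]; apply: (imset_inj enum_val_inj); rewrite imB.
apply/esym/maxA; first by rewrite base_indep /=.
by apply/subsetP => e /imsetP[k _ ->]; apply: enum_valP.
Qed.

End AdaptedCurve.

(** * The tautological map on the cones of the permutahedral fan *)

Section Tautological.
Variables (R : realType) (m : nat) (M : matroid 'I_m).
Hypothesis lfM : loopfree M.
Local Notation V := {ffun 'I_m -> R}.
Local Notation L := {ffun 'I_m -> int}.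
Local Notation Phi := (@tautological R m M).
Implicit Types (s : 'S_m) (x y z : V) (e b : 'I_m) (u : L).

Lemma cone_le s x e f : perm_cone s x -> (place s f <= place s e)%N -> x e <= x f.
Proof. by move=> sx /sx; rewrite !placeK. Qed.

Lemma cone_lt s x e f : perm_cone s x -> x e < x f -> (place s f < place s e)%N.
Proof.
by move=> sx xef; rewrite ltnNge; apply/negP => /(cone_le sx); rewrite leNgt xef.
Qed.

Lemma span_superlevel s x e t : perm_cone s x ->
  (e \in span M [set j | t <= x j]%SET) = (t <= x (leader M s e)).
Proof.
move=> sx; set f := leader M s e; apply/idP/idP => [|tf].
  rewrite leNgt => et; apply/negP => ft.
  have : e \in span M (upto s (place s f)).
    apply: subsetP et; apply/span_mono/subsetP => j; rewrite !inE => tj.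
    by apply: (cone_lt sx); apply: lt_le_trans ft tj.
  by rewrite mem_span_upto // ltnn.
have : e \in span M (upto s (place s f).+1) by rewrite mem_span_upto.
apply/subsetP/span_mono/subsetP => j; rewrite !inE ltnS => /(cone_le sx).
exact: le_trans.
Qed.

Lemma tautologicalE s x e : perm_cone s x -> Phi x e = x (leader M s e).
Proof.
move=> sx; rewrite ffunE -[RHS]sup_lower_ray; congr (reals.sup _).
by apply/seteqP; split=> t /=; rewrite (span_superlevel e t sx).
Qed.

(** The element e is spanned by the superlevel set of x at the level x e; the
    supremum is finite because the empty set spans nothing. *)
Lemma tautological_ge x e : x e <= Phi x e.
Proof.
rewrite ffunE; apply: ub_le_sup; last first.
  by apply: (subsetP (sub_span _ _)); rewrite inE.
exists (\sum_j `|x j|) => t /= te.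
have [z0|/set0Pn[j]] := eqVneq [set j | t <= x j]%SET finset.set0.
  by move: te; rewrite z0 loopfree_span0 // inE.
rewrite inE => /le_trans; apply; apply: le_trans (ler_norm _) _.
by rewrite (bigD1 j) //= lerDl sumr_ge0.
Qed.

Lemma place_tperm (i j : 'I_m) s e :
  place (tperm i j * s)%g e = tperm i j (place s e).
Proof. by rewrite /place invMg permM tpermV. Qed.

(** The same basis serves on both sides of the wall where the places i and j are
    exchanged, because it spans the superlevel sets of the points of either
    cone. *)
Lemma adapted_tautological s (i j : 'I_m) x : j = i.+1 :> nat ->
  perm_cone s x \/ perm_cone (tperm i j * s)%g x ->
  adapted M (greedy M s) (Phi x).
Proof.
move=> ij sx; have [s1 s1x] : exists s1, perm_cone s1 x.
  by case: sx; [exists s|eexists; eassumption].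
split; first exact: greedy_base.
move=> e t; pose A := [set k | t <= x k]%SET.
have lev f : (t <= Phi x f) = (f \in span M A).
  by rewrite (tautologicalE f s1x) -(span_superlevel f t s1x).
have -> : [set b in greedy M s | t <= Phi x b]%SET = greedy M s :&: span M A.
  by apply/setP => f; rewrite in_setI [LHS]in_set lev.
rewrite lev (greedy_span lfM ij) // => f g; rewrite inE => tf gf.
case: sx => [sx|sx]; first by left; rewrite inE (le_trans tf) // (cone_le sx) // ltnW.
have [le|lt] := leqP (place (tperm i j * s)%g g) (place (tperm i j * s)%g f).
  by left; rewrite inE (le_trans tf) // (cone_le sx).
by right; apply: (tperm_swap_lt ij gf); rewrite -!place_tperm.
Qed.

End Tautological.

(** * Global generation *)

Section GlobalGeneration.
Variables (R : realType) (m : nat) (M : matroid 'I_m).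
Hypothesis lfM : loopfree M.
Local Notation V := {ffun 'I_m -> R}.
Local Notation L := {ffun 'I_m -> int}.
Local Notation Phi := (@tautological R m M).
Implicit Types (s : 'S_m) (x y z : V) (e b : 'I_m) (u : L).

Definition unit_form b : L := [ffun k => (k == b)%:R].

(** For 0 < k < m these generate the cone of s modulo its lineality space, which
    is generated by the one for k = m. *)
Definition upto_indicator s (k : nat) : V := [ffun e => (place s e < k)%N%:R].

Lemma upto_indicator_cone s k : perm_cone s (upto_indicator s k).
Proof.
move=> p q pq; rewrite !ffunE !place_perm ler_nat.
by case: (ltnP q k) => // qk; rewrite (leq_ltn_trans pq qk).
Qed.

Lemma pairing_unit b x : pairing (unit_form b) x = x b.
Proof.
rewrite /pairing (bigD1 b) //= ffunE eqxx mul1r big1 ?addr0 // => k /negPf kb.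
by rewrite ffunE kb mul0r.
Qed.

Lemma unit_form_inj : injective unit_form.
Proof.
move=> b c /ffunP/(_ b); rewrite !ffunE eqxx.
by case: eqVneq.
Qed.

(** Consecutive indicators of initial segments differ by a unit vector. *)
Lemma pairing_cone_inj s u v :
  (forall x, perm_cone s x -> pairing u x = pairing v x) -> u = v.
Proof.
move=> uv; apply/ffunP => e; apply: (@intr_inj R).
have coord w : pairing w (upto_indicator s (place s e).+1) -
    pairing w (upto_indicator s (place s e)) = (w e)%:~R :> R.
  rewrite /pairing -sumrB (bigD1 e) //= !ffunE ltnSn ltnn mulr1 mulr0 subr0.
  rewrite big1 ?addr0 // => k /negPf ke; rewrite !ffunE -mulrBr ltnS leq_eqVlt.
  by rewrite val_eqE (inj_eq perm_inj) ke /= subrr mulr0.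
by rewrite -!coord !uv //; apply: upto_indicator_cone.
Qed.

Lemma fibE s u e :
  e \in fib Phi s u <-> forall x, perm_cone s x -> pairing u x <= x (leader M s e).
Proof.
rewrite inE; split=> [/asboolP h x sx|h].
  by rewrite -(tautologicalE lfM e sx) h.
by apply/asboolP => x sx; rewrite (tautologicalE lfM e sx) h.
Qed.

Lemma fib_unit s b : fib Phi s (unit_form b) = span M (upto s (place s b).+1).
Proof.
apply/setP => e; rewrite mem_span_upto // ltnS; apply/idP/idP => [/fibE h|le].
  have := h _ (upto_indicator_cone s (place s b).+1).
  by rewrite pairing_unit !ffunE ltnSn ler_nat lt0b.
by apply/fibE => x sx; rewrite pairing_unit; apply: cone_le le.
Qed.

(** An element e of a strictly smaller step of the filtration has a leader c with
    x_b <= x_c on the cone. Here c = b would force the larger character to be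
    the unit form of b, so c comes strictly before b; conversely, the unit forms
    of the elements before b account for all of these. *)
Lemma fib_gt_unit s b : fib_gt M Phi s (unit_form b) = span M (upto s (place s b)).
Proof.
apply/eqP; rewrite eqEsubset; apply/andP; split; apply: span_sub.
  apply/subsetP => e; rewrite inE => /asboolP[u' [neq ge /fibE eu]].
  rewrite mem_span_upto // ltn_neqAle; apply/andP; split.
    apply: contraNneq neq => /place_inj eb; apply/eqP/(pairing_cone_inj (s := s)).
    move=> x sx; apply/eqP; rewrite eq_le ge // andbT.
    by rewrite pairing_unit -[in leRHS]eb eu.
  have := le_trans (ge _ _) (eu _ _).
  move/(_ _ (upto_indicator_cone s (place s b).+1) (upto_indicator_cone _ _)).
  by rewrite pairing_unit !ffunE ltnSn ler_nat lt0b.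
apply/subsetP => e; rewrite inE => eb; apply: (subsetP (sub_span _ _)).
rewrite inE; apply/asboolP; exists (unit_form e); split.
- by rewrite (inj_eq unit_form_inj); apply: contraTneq eb => ->; rewrite ltnn.
- by move=> x sx; rewrite !pairing_unit; apply: cone_le sx (ltnW eb).
- by apply/fibE => x sx; rewrite pairing_unit; apply: cone_le sx (leader_le _ _ _).
Qed.

(** Membership of e depends only on the leader of e and is inherited by earlier
    leaders; an element of the span cannot have a leader later than all those of
    the spanning elements. *)
Lemma fib_flat s u : span M (fib Phi s u) = fib Phi s u.
Proof.
apply/eqP; rewrite eqEsubset sub_span andbT; apply/subsetP => e eF.
have /subsetPn[f /fibE fu fN] :
    ~~ (fib Phi s u \subset span M (upto s (place s (leader M s e)))).
  apply/negP => /span_sub/subsetP/(_ e eF).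
  by rewrite mem_span_upto // ltnn.
apply/fibE => x sx; apply: le_trans (fu x sx) _; apply: (cone_le sx).
by rewrite mem_span_upto // -leqNgt in fN.
Qed.

(** An element e of F_u also lies in F_u' for the unit form u' of its leader,
    which dominates u on the cone and differs from u. *)
Lemma fib_gt_nongreedy s u : (forall b, b \in greedy M s -> u <> unit_form b) ->
  fib_gt M Phi s u = fib Phi s u.
Proof.
move=> nu; apply/eqP; rewrite eqEsubset; apply/andP; split.
  rewrite -[fib Phi s u]fib_flat; apply/span_mono/subsetP => e.
  rewrite inE => /asboolP[u' [_ ge /fibE eu']]; apply/fibE => x sx.
  exact: le_trans (ge x sx) (eu' x sx).
apply: subset_trans (sub_span _ _); apply/subsetP => e /fibE eu.
rewrite inE; apply/asboolP; exists (unit_form (leader M s e)); split.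
- by apply/eqP => /esym; apply/nu/leader_greedy.
- by move=> x sx; rewrite pairing_unit eu.
- by apply/fibE => x sx; rewrite pairing_unit.
Qed.

Lemma tautological_globally_generated : globally_generated M Phi.
Proof.
move=> s; pose S := [set p : 'I_m * L | p.1 \in greedy M s /\ p.2 = unit_form p.1]%classic.
exists S; last first.
  move=> b u [/= bG ->]; split.
    by rewrite inE; apply/asboolP => x; rewrite pairing_unit tautological_ge.
  by rewrite fib_gt_unit -greedyE.
move=> u; have [[b bG ->]|nu] := pselect (exists2 b, b \in greedy M s & u = unit_form b).
  exists [set b]%SET; last first.
    move=> e; rewrite inE; split=> [[_ /= /unit_form_inj->//]|/eqP->]; by [].
  have [iI sI] := greedy_upto s lfM (place s b).
  have [iI' sI'] := greedy_upto s lfM (place s b).+1.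
  have bN : b \notin span M (upto s (place s b)) by rewrite -greedyE.
  rewrite /minor_basis fib_unit fib_gt_unit sub1set inE bN.
  rewrite (subsetP (sub_span _ _)) ?inE //=.
  apply/existsP; exists (greedy M s :&: upto s (place s b)); apply/andP; split.
    apply: restr_basis_span => //; last exact: span_sub.
    by apply: subset_trans (subsetIr _ _) (sub_span _ _).
  have -> : greedy M s :&: upto s (place s b) :|: [set b] =
            greedy M s :&: upto s (place s b).+1.
    by rewrite uptoS setIUr [in RHS]setUC; congr (_ :|: _); apply/esym/setIidPr; rewrite sub1set.
  apply: restr_basis_span => //; last exact: span_sub.
  by apply: subset_trans (subsetIr _ _) (sub_span _ _).
exists finset.set0; last first.
  move=> e; rewrite inE; split=> // -[/= eG ue]; case: nu; by exists e.
rewrite /minor_basis sub0set /= fib_gt_nongreedy; last first.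
  by move=> b bG ub; apply: nu; exists b.
have [I [iI IF cI]] := max_indep M (fib Phi s u).
have bI : restr_basis M (fib Phi s u) I.
  apply: restr_basis_span => //; apply/subsetP => e eF.
  by rewrite (span_indep _ iI) -(span_max_indep _ iI IF cI) (subsetP (sub_span _ _)).
by apply/existsP; exists I; rewrite setU0 bI.
Qed.

End GlobalGeneration.

(** * Crossing a wall of the permutahedral fan *)

Section Wall.
Variables (R : realType) (m : nat).
Local Notation V := {ffun 'I_m -> R}.
Local Notation L := {ffun 'I_m -> int}.
Variables (s : 'S_m) (i j : 'I_m).
Hypothesis ij : j = i.+1 :> nat.
Implicit Types (x y : V) (e f : 'I_m).

Lemma pairing_unitB e f y :
  pairing (unit_form e - unit_form f) y = y e - y f.
Proof.
rewrite -!pairing_unit /pairing -sumrB; apply: eq_bigr => k _.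
by rewrite !ffunE rmorphB mulrBl.
Qed.

(** A primitive normal is determined up to sign as a generator of an infinite
    cyclic group; the sign is read off at the indicator of the initial segment
    that ends with s i, an element of the cone off the wall. *)
Lemma wall_normal (eta : L) :
  primitive_normal (wall (R := R) s i j) (perm_cone (R := R) s) eta ->
  eta = unit_form (s i) - unit_form (s j).
Proof.
move=> [gen pos]; have [gen0 _] := wall_primitive_normal R s ij.
set eta0 := [ffun k => _] in gen0.
have eta0E : eta0 = unit_form (s i) - unit_form (s j).
  by apply/ffunP => k; rewrite !ffunE.
rewrite -eta0E; have [k etak] : exists k : int, eta = eta0 *~ k.
  by apply/gen0/gen; exists 1; rewrite mulr1z.
have [l eta0l] : exists l : int, eta0 = eta *~ l.
  by apply/gen/gen0; exists 1; rewrite mulr1z.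
have sij : s i == s j = false.
  by apply/negP => /eqP/perm_inj/(congr1 val)/=; rewrite ij => /n_Sn.
have eta0i : eta0 (s i) = 1 by rewrite ffunE eqxx sij subr0.
have kl : k * l = 1.
  have := congr1 (fun u : L => u (s i)) eta0l.
  by rewrite etak -mulrzA ffunMzE -mulrzr intz eta0i mul1r => <-.
have p (u : L) (n : int) (z : V) : pairing (u *~ n) z = n%:~R * pairing u z.
  rewrite /pairing mulr_sumr; apply: eq_bigr => q _.
  by rewrite ffunMzE -[u q *~ n]mulrzr intz intrM mulrAC mulrC.
have k0 : 0 <= k.
  have := pos _ (upto_indicator_cone R s i.+1).
  rewrite etak p eta0E pairing_unitB !ffunE !place_perm ltnSn ij ltnn.
  by rewrite subr0 mulr1 ler0z.
rewrite etak; suff -> : k = 1 by rewrite mulr1z.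
have /eqP := congr1 absz kl; rewrite abszM muln_eq1 => /andP[/eqP k1 _].
by rewrite -(gez0_abs k0) k1.
Qed.

(** The indicator of an initial segment other than the one separating s i from
    s j lies in the wall; a small multiple of it may be subtracted from a relative
    interior point, whose coordinates on both sides of that segment are
    therefore distinct. *)
Lemma relint_wall x : relint (wall s i j) x ->
  perm_cone s x /\ forall e f, (place s e < place s f)%N -> x e = x f ->
  place s e = i /\ place s f = j.
Proof.
move=> [wx [eps eps0 int]]; split=> [|e f ef xef]; first by case: wx.
have sep k : k != i.+1 -> ~ (place s e < k <= place s f)%N.
  move=> ki /andP[ek kf]; pose d := (eps / 2) *: upto_indicator R s k.
  have dE p : d p = eps / 2 * (place s p < k)%N%:R by rewrite !ffunE.
  have xdE p : (x - d) p = x p - eps / 2 * (place s p < k)%N%:R by rewrite !ffunE.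
  have wd : wall s i j d.
    split=> [p q pq|]; rewrite !dE.
      have := upto_indicator_cone R s k pq; rewrite !ffunE.
      by apply: ler_wpM2l; rewrite divr_ge0 // ltW.
    by rewrite !place_perm ij [in RHS]ltn_neqAle eq_sym ki.
  have [|+ _] := int x d wx wd.
    move=> p; rewrite addrAC subrr sub0r normrN.
    rewrite dE ger0_norm ?mulr_ge0 ?divr_ge0 ?ler0n ?ltW //.
    by case: (place s p < k)%N => /=; lra.
  move=> /(cone_le)/(_ (ltnW ef)); rewrite !xdE ek ltnNge kf /= xef.
  by lra.
have [fj|fj] := eqVneq (place s f) j; last first.
  by case: (sep (place s f)); rewrite ?ef ?leqnn // -ij.
have [ei|ei] := eqVneq (place s e) i; first by [].
by case: (sep (place s e).+1); rewrite ?ltnSn.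
Qed.

Lemma near_order x y : \forall eps \near at_right (0 : R),
  forall e f, x f < x e -> (x + eps *: y) f < (x + eps *: y) e.
Proof.
apply: filter_forall => e; apply: filter_forall => f.
have [xfe|le] := ltP (x f) (x e); last by apply: nearW.
pose c := (x e - x f) / (`|y f - y e| + 1).
have c0 : 0 < `|y f - y e| + 1 by rewrite ltr_wpDl.
near=> eps => _.
have eps0 : 0 < eps by near: eps; apply: nbhs_right_gt.
have : eps < c by near: eps; apply: nbhs_right_lt; rewrite divr_gt0 ?subr_gt0.
rewrite ltr_pdivlMr // => epsc.
have : eps * (y f - y e) <= eps * (`|y f - y e| + 1).
  by rewrite ler_pM2l // ler_wpDr ?ler_norm.
have zE p : (x + eps *: y) p = x p + eps * y p by rewrite !ffunE.
by rewrite !zE; lra.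
Unshelve. all: by end_near.
Qed.

(** A small displacement along y keeps a point in a closed cone as soon as y does
    not break the ties of that point the wrong way. *)
Lemma near_cone (t : 'S_m) x y : perm_cone t x ->
  (forall e f, (place t e < place t f)%N -> x e = x f -> y f <= y e) ->
  \forall eps \near at_right (0 : R), perm_cone t (x + eps *: y).
Proof.
move=> tx ty; near=> eps.
have eps0 : 0 < eps by near: eps; apply: nbhs_right_gt.
have ord : forall e f, x f < x e -> (x + eps *: y) f < (x + eps *: y) e.
  by near: eps; apply: near_order.
move=> p q pq; have [/ord/ltW//|le] := ltP (x (t q)) (x (t p)).
have xE : x (t p) = x (t q) by apply/eqP; rewrite eq_le le tx.
move: pq; rewrite leq_eqVlt => /orP[/eqP/val_inj->//|pq].
rewrite !ffunE xE lerD2l; apply: ler_wpM2l; first exact: ltW.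
by apply: ty; rewrite ?place_perm.
Unshelve. all: by end_near.
Qed.

Variable M : matroid 'I_m.
Hypothesis lfM : loopfree M.
Local Notation Phi := (@tautological R m M).
Local Notation s' := (tperm i j * s)%g.

(** Both x and x + eps y lie in the cone of t for small eps, so the difference
    quotient is constant there. *)
Lemma restriction_map (t : 'S_m) x y e : perm_cone t x ->
  (forall e f, (place t e < place t f)%N -> x e = x f -> y f <= y e) ->
  cb_map (restriction M Phi x) y e = y (leader M t e).
Proof.
move=> tx ty; rewrite ffunE; apply: (lim_near_cst (@Rhausdorff R)).
near=> eps.
have eps0 : 0 < eps by near: eps; apply: nbhs_right_gt.
have tz : perm_cone t (x + eps *: y) by near: eps; apply: near_cone.
rewrite (tautologicalE lfM e tz) (tautologicalE lfM e tx) !ffunE addrAC subrr add0r.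
by rewrite mulrAC mulfV ?mul1r // gt_eqF.
Unshelve. all: by end_near.
Qed.

Lemma adapted_restriction (t : 'S_m) x y : t = s \/ t = s' ->
  perm_cone s x -> perm_cone t x ->
  (forall e f, (place t e < place t f)%N -> x e = x f -> y f <= y e) ->
  adapted (initial M (Phi x)) (greedy M s) (cb_map (restriction M Phi x) y).
Proof.
move=> ts sx tx ty.
have [eps [eps0 ord tz]] : exists eps : R, [/\ 0 < eps,
    forall e f, x f < x e -> (x + eps *: y) f < (x + eps *: y) e &
    perm_cone t (x + eps *: y)].
  apply: (@filter_ex _ (at_right (0 : R))); near=> eps; split; near: eps.
  - exact: nbhs_right_gt.
  - exact: near_order.
  - exact: near_cone.
have [ax az] : adapted M (greedy M s) (Phi x) /\ adapted M (greedy M s) (Phi (x + eps *: y)).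
  by split; apply: (adapted_tautological lfM ij); [left|case: ts tz => ->; [left|right]].
apply: (adapted_initial_dir eps0 _ _ ax az) => [e|e f].
  by rewrite (restriction_map e tx ty) (tautologicalE lfM e tz) (tautologicalE lfM e tx) !ffunE.
by rewrite !(tautologicalE lfM _ tz) !(tautologicalE lfM _ tx); apply: ord.
Unshelve. all: by end_near.
Qed.

(** Crossing the wall changes the leader of a greedy element only if the two
    exchanged elements are parallel over those before them; the coordinate is
    then the maximum of two linear forms, whence degree 1. *)
Lemma greedy_leader_across b x : relint (wall s i j) x -> b \in greedy M s ->
  leader M s' b != b -> b = s i /\ leader M s' b = s j.
Proof.
move=> rx bG; set c := leader M s' b => cb.
have [sx tie] := relint_wall rx.
have s'x : perm_cone s' x by case: rx => + _; rewrite wallE // => -[].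
have xcb : x c = x b.
  rewrite -(tautologicalE lfM b s'x) (tautologicalE lfM b sx).
  by move: bG; rewrite inE => /eqP->.
have [cbs|] := ltnP (place s c) (place s b).
  have [ci bj] := tie c b cbs xcb.
  have := leader_le s' lfM b; rewrite !place_tperm -/c ci bj tpermL tpermR ij.
  by rewrite ltnn.
rewrite leq_eqVlt => /orP[/eqP/place_inj bc|bcs]; first by rewrite bc eqxx in cb.
by have [<- <-] := tie b c bcs (esym xcb); rewrite !placeK.
Qed.

End Wall.

Lemma tautological_nef (R : realType) (m : nat) (M : matroid 'I_m) :
  loopfree M -> nef M (@tautological R m M).
Proof.
move=> lfM s i j eta x ij /(wall_normal ij) etaE rx.
set Phi := tautological M; set t := (tperm i j * s)%g.
have [sx tie] := relint_wall ij rx.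
have tx : perm_cone t x by case: rx => + _; rewrite wallE // => -[].
have pE (y : {ffun 'I_m -> R}) : pairing eta y = y (s i) - y (s j) by rewrite etaE pairing_unitB.
have ordp (y : {ffun 'I_m -> R}) : 0 <= pairing eta y ->
    forall e f, (place s e < place s f)%N -> x e = x f -> y f <= y e.
  rewrite pE subr_ge0 => yij e f ef xef; have [ei fj] := tie e f ef xef.
  by rewrite -(placeK s e) -(placeK s f) ei fj.
have ordm (y : {ffun 'I_m -> R}) : pairing eta y <= 0 ->
    forall e f, (place t e < place t f)%N -> x e = x f -> y f <= y e.
  rewrite pE subr_le0 => yij e f; rewrite !place_tperm => ef xef.
  have [lt|lt|/place_inj eqef] := ltngtP (place s e) (place s f).
  - have [ei fj] := tie e f lt xef.
    by move: ef; rewrite ei fj tpermL tpermR ij ltnNge leqnSn.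
  - have [fi ej] := tie f e lt (esym xef).
    by rewrite -(placeK s e) -(placeK s f) fi ej.
  - by rewrite eqef.
pose Psi := cb_map (restriction M Phi x).
have Psip y e : 0 <= pairing eta y -> Psi y e = y (leader M s e).
  by move/ordp; apply: restriction_map.
have Psim y e : pairing eta y <= 0 -> Psi y e = y (leader M t e).
  by move/ordm; apply: restriction_map.
pose B := greedy M s.
have aPsi y : adapted (initial M (Phi x)) B (Psi y).
  have [pos|/ltW neg] := leP 0 (pairing eta y).
    by apply: (adapted_restriction ij lfM _ sx sx (ordp y pos)); left.
  by apply: (adapted_restriction ij lfM _ sx tx (ordm y neg)); right.
exists #|B|, (fun k => (leader M t (enum_val k) != enum_val k)%:R),
  (CurveBundle (free_matroid 'I_#|B|) (fun y => [ffun k => Psi y (enum_val k)])).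
split=> [k|| ].
- by rewrite ler0n.
- exists (fun y => [ffun k => Psi y (enum_val k)]) => // k.
  set b := enum_val k; have bB : b \in B by apply: enum_valP.
  exists (unit_form b), (unit_form (leader M t b)); split.
  + have [->|cb] := eqVneq (leader M t b) b; first by rewrite subrr mulr0z.
    by have [-> ->] := greedy_leader_across ij lfM rx bB cb; rewrite mulr1z.
  + by move=> y /Psip h; rewrite ffunE h pairing_unit; move: bB; rewrite inE => /eqP->.
  + by move=> y /Psim h; rewrite ffunE h pairing_unit.
have linE l (y : {ffun 'I_m -> R}) :
    y l = \sum_k [ffun k => (unit_form l k)%:~R : R] k * y k.
  by rewrite -pairing_unit; apply: eq_bigr => k _; rewrite ffunE.
apply/rst_sym/rst_step/basis_extension => //.
- by move=> y iy e; have [/Psip->|/ltW/Psim->] := leP 0 (pairing eta y); apply: iy.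
- by move=> e; eexists => y /Psip->; apply: linE.
- by move=> e; eexists => y /Psim->; apply: linE.
Qed.

Theorem theorem1p8 (R : realType) (m : nat) (M : matroid 'I_m)
  (loopfree_M : loopfree M) :
  globally_generated M (@tautological R m M) /\ nef M (@tautological R m M).
Proof.
by split; [apply: tautological_globally_generated|apply: tautological_nef].
Qed.
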